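(* Let $y\in\mathcal A$ and $i\in\{1,\dots,m\}$. Then $$\mathbf v(y)=\Phi_{\cdot,i}(y,y)+v_i(y)\,\mathbb 1\qquad\text{for every }\mathbf v\in\mathcal H(0).$$ In particular, $\mathbf v(y)-\mathbf w(y)\in\mathbb R\,\mathbb 1$ for any $\mathbf v,\mathbf w\in\mathcal H(0)$.
   Context: Let $N,m$ be positive integers, $\mathbb T^N=\mathbb R^N/\mathbb Z^N$ the flat torus, $\mathbb 1=(1,\dots,1)^T\in\mathbb R^m$. A convex Hamiltonian is a continuous $H:\mathbb T^N\times\mathbb R^N\to\mathbb R$ such that $p\mapsto H(x,p)$ is convex for every $x$ and there are $\alpha,\beta:\mathbb R_+\to\mathbb R$ tending to $+\infty$ at $+\infty$ with $\alpha(|p|)\leqslant H(x,p)\leqslant\beta(|p|)$ for all $(x,p)$. Let $H_1,\dots,H_m$ be convex Hamiltonians. An $m\times m$ real matrix $(b_{ij})$ is a coupling matrix if $b_{ij}\leqslant0$ for $j\ne i$ and $\sum_j b_{ij}\geqslant0$ for every $i$; it is degenerate if moreover $\sum_j b_{ij}=0$ for every $i$; a matrix is irreducible if for every nonempty $\mathcal I\subsetneq\{1,\dots,m\}$ there are $i\in\mathcal I$, $j\notin\mathcal I$ with $b_{ij}\neq0$. Let $B(x)=(b_{ij}(x))$ have continuous coefficients on $\mathbb T^N$ and be an irreducible degenerate coupling matrix for every $x$. Write $(B(x)\mathbf u(x))_i=\sum_j b_{ij}(x)u_j(x)$. For continuous $u$, $D^+u(x_0)$ (resp. $D^-u(x_0)$)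 is the set of $D\phi(x_0)$ with $\phi$ of class $C^1$ near $x_0$ and $u-\phi$ having a local maximum (resp. minimum) at $x_0$. For $a\in\mathbb R$, $\mathbf u\in(C(\mathbb T^N))^m$ is a (viscosity) subsolution [resp. supersolution] of $H_i(x,Du_i)+(B(x)\mathbf u(x))_i=a$ in $\mathbb T^N$, $i=1,\dots,m$, if for all $x$ and $i$: $H_i(x,p)+(B(x)\mathbf u(x))_i\leqslant a$ for all $p\in D^+u_i(x)$ [resp. $\geqslant a$ for all $p\in D^-u_i(x)$]; a solution is both. $\mathcal H(a)$ denotes the set of subsolutions. The critical value is $c=\inf\{a\in\mathbb R:\mathcal H(a)\neq\varnothing\}$; it is assumed, by normalization, that $c=0$. ''Critical'' sub/super/solutions refer to $a=0$. For $x,y\in\mathbb T^N$, $i,j\in\{1,\dots,m\}$ set $\Phi_{i,j}(y,x)=\sup_{\mathbf v\in\mathcal H(0)}\big(v_i(x)-v_j(y)\big)$, and let $\Phi_{\cdot,j}(y,\cdot)=(\Phi_{1,j}(y,\cdot),\dots,\Phi_{m,j}(y,\cdot))^T$. The Aubry set is $\mathcal A=\{y\in\mathbb T^N:\Phi_{\cdot,i}(y,\cdot)\text{ is a critical solution}\}$, where $i$ is any fixed index (the set does not depend on $i$). *)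

(* Defs.v *)
From HB Require Import structures.
From mathcomp Require Import all_boot all_order all_algebra.
From mathcomp Require Import all_classical all_reals all_analysis.

Set Implicit Arguments.
Unset Strict Implicit.
Unset Printing Implicit Defensive.

Import Order.TTheory GRing.Theory Num.Theory.
Import numFieldNormedType.Exports.

Local Open Scope classical_set_scope.
Local Open Scope ring_scope.

(* Functions on the flat torus R^N / Z^N are represented by their lifts, the
   Z^N-periodic functions on R^N; a point of the torus is represented by any
   point of R^N above it. *)
Definition periodic (R : realType) (N : nat) (T : Type) (f : 'rV[R]_N -> T) :=
  forall (x : 'rV[R]_N) (z : 'rV[int]_N), f (x + map_mx intr z) = f x.

Definition torus_continuous (R : realType) (N : nat) (f : 'rV[R]_N -> R) :=
  periodic f /\ continuous f.

(* The norm `|p| of the library is the sup norm. *)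
Definition euclidean_norm (R : realType) (N : nat) (p : 'rV[R]_N) : R :=
  Num.sqrt (\sum_(k < N) p 0 k ^+ 2).

(* alpha and beta stand for functions on R_+: their values at negative
   numbers are never constrained. *)
Definition convex_hamiltonian (R : realType) (N : nat)
    (H : 'rV[R]_N -> 'rV[R]_N -> R) :=
  [/\ forall p, periodic (H ^~ p),
      continuous (fun xp : 'rV[R]_N * 'rV[R]_N => H xp.1 xp.2),
      forall x, convex_function setT (H x)
    & exists alpha beta : R -> R,
        [/\ alpha r @[r --> +oo] --> +oo,
            beta r @[r --> +oo] --> +oo
          & forall x p, alpha (euclidean_norm p) <= H x p
                          <= beta (euclidean_norm p)]].

Definition coupling_matrix (R : realType) (m : nat) (B : 'M[R]_m) :=
  (forall i j, j != i -> B i j <= 0) /\ (forall i, 0 <= \sum_(j < m) B i j).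

Definition degenerate_coupling_matrix (R : realType) (m : nat) (B : 'M[R]_m) :=
  coupling_matrix B /\ (forall i, \sum_(j < m) B i j = 0).

Definition irreducible_matrix (R : realType) (m : nat) (B : 'M[R]_m) :=
  forall I : {set 'I_m}, I != finset.set0 -> I \proper [set: 'I_m]%SET ->
    exists i j, [/\ i \in I, j \notin I & B i j != 0].

Definition gradient (R : realType) (N : nat) (phi : 'rV[R]_N -> R)
    (x : 'rV[R]_N) : 'rV[R]_N :=
  \row_(k < N) 'd phi x (delta_mx 0 k).

Definition C1_near (R : realType) (N : nat) (phi : 'rV[R]_N -> R)
    (x0 : 'rV[R]_N) :=
  \forall x \near x0,
    differentiable phi x /\ {for x, continuous (gradient phi)}.

Definition superdifferential (R : realType) (N : nat) (u : 'rV[R]_N -> R)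
    (x0 : 'rV[R]_N) : set 'rV[R]_N :=
  [set p | exists phi : 'rV[R]_N -> R,
    [/\ C1_near phi x0, gradient phi x0 = p
      & \forall x \near x0, u x - phi x <= u x0 - phi x0]].

Definition subdifferential (R : realType) (N : nat) (u : 'rV[R]_N -> R)
    (x0 : 'rV[R]_N) : set 'rV[R]_N :=
  [set p | exists phi : 'rV[R]_N -> R,
    [/\ C1_near phi x0, gradient phi x0 = p
      & \forall x \near x0, u x0 - phi x0 <= u x - phi x]].

Definition coupling_term (R : realType) (N m : nat) (B : 'rV[R]_N -> 'M[R]_m)
    (u : 'I_m -> 'rV[R]_N -> R) (i : 'I_m) (x : 'rV[R]_N) : R :=
  \sum_(j < m) B x i j * u j x.

Definition subsolution (R : realType) (N m : nat)
    (H : 'I_m -> 'rV[R]_N -> 'rV[R]_N -> R) (B : 'rV[R]_N -> 'M[R]_m) (a : R)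
    (u : 'I_m -> 'rV[R]_N -> R) :=
  (forall i, torus_continuous (u i)) /\
  (forall x i p, superdifferential (u i) x p ->
     H i x p + coupling_term B u i x <= a).

Definition supersolution (R : realType) (N m : nat)
    (H : 'I_m -> 'rV[R]_N -> 'rV[R]_N -> R) (B : 'rV[R]_N -> 'M[R]_m) (a : R)
    (u : 'I_m -> 'rV[R]_N -> R) :=
  (forall i, torus_continuous (u i)) /\
  (forall x i p, subdifferential (u i) x p ->
     a <= H i x p + coupling_term B u i x).

Definition solution (R : realType) (N m : nat)
    (H : 'I_m -> 'rV[R]_N -> 'rV[R]_N -> R) (B : 'rV[R]_N -> 'M[R]_m) (a : R)
    (u : 'I_m -> 'rV[R]_N -> R) :=
  subsolution H B a u /\ supersolution H B a u.

Definition subsolutions (R : realType) (N m : nat)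
    (H : 'I_m -> 'rV[R]_N -> 'rV[R]_N -> R) (B : 'rV[R]_N -> 'M[R]_m) (a : R) :
    set ('I_m -> 'rV[R]_N -> R) :=
  [set u | subsolution H B a u].

Definition critical_value (R : realType) (N m : nat)
    (H : 'I_m -> 'rV[R]_N -> 'rV[R]_N -> R) (B : 'rV[R]_N -> 'M[R]_m) :
    \bar R :=
  ereal_inf [set a%:E | a in [set a : R | subsolutions H B a !=set0]].

(* The supremum is taken in the extended reals, so that its value is
   meaningful without a proof that the set is bounded. *)
Definition Phi (R : realType) (N m : nat)
    (H : 'I_m -> 'rV[R]_N -> 'rV[R]_N -> R) (B : 'rV[R]_N -> 'M[R]_m)
    (i j : 'I_m) (y x : 'rV[R]_N) : \bar R :=
  ereal_sup [set (v i x - v j y)%:E | v in subsolutions H B 0].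

(* The Aubry set defined by means of the index j; it is a Z^N-periodic subset
   of R^N. *)
Definition aubry_set (R : realType) (N m : nat)
    (H : 'I_m -> 'rV[R]_N -> 'rV[R]_N -> R) (B : 'rV[R]_N -> 'M[R]_m)
    (j : 'I_m) : set 'rV[R]_N :=
  [set y | exists2 u : 'I_m -> 'rV[R]_N -> R,
     solution H B 0 u & forall i x, Phi H B i j y x = (u i x)%:E].

(* Main.v *)
Require Import Defs.
From HB Require Import structures.
From mathcomp Require Import all_boot all_order all_algebra.
From mathcomp Require Import all_classical all_reals all_analysis.
From mathcomp Require Import ring lra.

Import Order.TTheory GRing.Theory Num.Theory.
Import numFieldNormedType.Exports.

Local Open Scope classical_set_scope.
Local Open Scope ring_scope.

(** Let [u = Phi_(., j)(y, .)], which is a critical solution because [y] is in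
    the Aubry set, and let [v] be a critical subsolution.  By definition of
    [Phi], [v_k - v_j(y) <= u_k] everywhere, and for [k = j] both sides vanish
    at [y].  Let [I] be the set of the indices [k] for which equality holds at
    [y]; the point is to show that [I] contains every index.

    If it does not, irreducibility of [B(y)] gives [l] in [I] and [k] outside
    [I] with [b_lk(y) < 0].  Since [sum_h b_lh(y) = 0] and [b_lh(y) <= 0] off
    the diagonal, the coupling term of [v] in the equation [l] is at [y]
    strictly larger than that of [u].  Freezing the coupling terms, [v_l]
    satisfies [H_l(x, Dv_l) <= g(x)] and [u_l] satisfies
    [H_l(x, Du_l) >= f(x)], with [g(y) < f(y)], while [u_l - v_l] is minimal at
    [y].  This is impossible: if the two functions were differentiable at [y]
    they would have the same gradient there.

    For merely continuous functions, the last step is lemma [contact].  It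
    rests on the doubling of variables (lemma [doubling]), which provides, as
    near to [y] as desired, a superdifferential of [v_l] at [z] and a
    subdifferential of [u_l] at [x] that differ by [2 (x - y)] only.  These
    gradients may depend on the neighbourhood of [y]; coercivity of [H_l]
    bounds them, and continuity of [H_l] is used uniformly on that bounded set.

    Hence [v_k(y) - v_j(y) = u_k(y)] for all [k], a value that depends on [y]
    but not on [v].  So [v_k(y) - v_i(y)] is also the same for all
    subsolutions [v], whatever the index [i], and the supremum that defines
    [Phi_(k, i)(y, y)] is taken over a single value. *)

Set Implicit Arguments.
Unset Strict Implicit.
Unset Printing Implicit Defensive.

(** * Continuity *)

Lemma continuous_sum (T : topologicalType) (R : realType) (n : nat)
    (F : 'I_n -> T -> R) :
  (forall k, continuous (F k)) -> continuous (fun x => \sum_(k < n) F k x).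
Proof. by move=> cF; apply: continuous_big => //; exact: add_continuous. Qed.

Lemma continuous_comp_fst (T U V : topologicalType) (f : T -> V) :
  continuous f -> continuous (fun p : T * U => f p.1).
Proof. by move=> cf p; apply: continuous_comp (cf _); exact: cvg_fst. Qed.

Lemma continuous_comp_snd (T U V : topologicalType) (f : U -> V) :
  continuous f -> continuous (fun p : T * U => f p.2).
Proof. by move=> cf p; apply: continuous_comp (cf _); exact: cvg_snd. Qed.

Lemma continuous_comp2 (T U V W : topologicalType) (h : U -> V -> W)
    (f : T -> U) (g : T -> V) :
  continuous (fun p : U * V => h p.1 p.2) -> continuous f -> continuous g ->
  continuous (fun t => h (f t) (g t)).
Proof.
move=> ch cf cg t.
apply: (@continuous_comp _ _ _ (fun t => (f t, g t)) (fun p => h p.1 p.2)).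
  exact: cvg_pair (cf t) (cg t).
exact: ch.
Qed.

Lemma nbhs_gt (T : topologicalType) (R : realType) (f : T -> R) (x : T) (r : R) :
  continuous f -> r < f x -> nbhs x [set z | r < f z].
Proof. by move=> cf; exact: (cvgr_gt _ (cf x)). Qed.

Lemma nbhs_lt (T : topologicalType) (R : realType) (f : T -> R) (x : T) (r : R) :
  continuous f -> f x < r -> nbhs x [set z | f z < r].
Proof. by move=> cf; exact: (cvgr_lt _ (cf x)). Qed.

Lemma continuous_dist (R : realType) (N : nat) (a : 'rV[R]_N) :
  continuous (fun x : 'rV[R]_N => `|x - a|).
Proof.
move=> x; apply: (@continuous_comp _ _ _ (fun x : 'rV[R]_N => x - a));
  last exact: norm_continuous.
by apply: continuousB; [exact: cvg_id|exact: cst_continuous].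
Qed.

Lemma compact_ball (R : realType) (N : nat) (a : 'rV[R]_N) (r : R) :
  compact [set x : 'rV[R]_N | `|x - a| <= r].
Proof.
apply: bounded_closed_compact.
  exists (r + `|a|); split; first exact: num_real.
  move=> M rM x /= xr; apply: ltW; apply: le_lt_trans rM.
  by rewrite -(subrK a x) (le_trans (ler_normD _ _))// lerD2r.
exact: (closed_comp (fun x _ => @continuous_dist _ _ a x) (@closed_le _ r)).
Qed.

(** * Quadratic test functions *)

(** The sup norm is not differentiable, hence the square of the euclidean
    distance as a penalty. *)
Definition sqdist (R : realType) (N : nat) (a x : 'rV[R]_N) : R :=
  \sum_(k < N) (x 0 k - a 0 k) ^+ 2.

Lemma sqdist_ge0 (R : realType) (N : nat) (a x : 'rV[R]_N) : 0 <= sqdist a x.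
Proof. by apply: sumr_ge0 => k _; exact: sqr_ge0. Qed.

Lemma sqdistxx (R : realType) (N : nat) (a : 'rV[R]_N) : sqdist a a = 0.
Proof. by apply: big1 => k _; rewrite subrr expr0n. Qed.

Lemma sqdist_gt0 (R : realType) (N : nat) (a x : 'rV[R]_N) :
  x != a -> 0 < sqdist a x.
Proof.
move=> xa; rewrite lt_neqAle sqdist_ge0 andbT eq_sym.
apply: contra xa => /eqP s0; apply/eqP/rowP => k; apply/eqP.
rewrite -subr_eq0 -sqrf_eq0; apply/eqP.
by apply: (psumr_eq0P _ s0) => // i _; exact: sqr_ge0.
Qed.

Lemma sqdistC (R : realType) (N : nat) (a x : 'rV[R]_N) :
  sqdist a x = sqdist x a.
Proof. by apply: eq_bigr => k _; rewrite -sqrrN opprB. Qed.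

Lemma sqdist_continuous (R : realType) (N : nat) :
  continuous (fun p : 'rV[R]_N * 'rV[R]_N => sqdist p.2 p.1).
Proof.
apply: continuous_sum => k p.
apply: (@cvg_comp _ _ _ (fun p : 'rV[R]_N * 'rV[R]_N => p.1 0 k - p.2 0 k)
  (fun r => r ^+ 2)); last exact: exprn_continuous.
apply: cvgB.
  by move: p; apply: (@continuous_comp_fst _ _ _ (fun x : 'rV[R]_N => x 0 k));
    exact: coord_continuous.
by move: p; apply: (@continuous_comp_snd _ _ _ (fun x : 'rV[R]_N => x 0 k));
  exact: coord_continuous.
Qed.

Lemma is_derive_coord (R : realType) (N : nat) (x v : 'rV[R]_N) (k : 'I_N) :
  is_derive x v (fun z : 'rV[R]_N => z 0 k) (v 0 k).
Proof.
have D := @differentiable_coord R 1 N x 0 k.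
apply: DeriveDef; first exact: diff_derivable.
apply/cvg_lim => //.
apply: cvg_near_cst; near=> h.
rewrite /= !mxE /GRing.scale/= addrK mulrA mulVf ?mul1r//.
near: h; exact: nbhs_dnbhs_neq.
Unshelve. all: by end_near. Qed.

Lemma is_derive_sqdist (R : realType) (N : nat) (a x v : 'rV[R]_N) :
  is_derive x v (sqdist a) (\sum_(k < N) 2 * (x 0 k - a 0 k) * v 0 k).
Proof.
pose h (k : 'I_N) (z : 'rV[R]_N) : R := (z 0 k - a 0 k) ^+ 2.
have -> : sqdist a = \sum_(k < N) h k by apply/funext => z; rewrite fct_sumE.
apply: is_derive_sum => k.
have D := is_derive_coord x v k.
apply: (is_derive_eq (is_deriveX 2 (is_deriveB D (is_derive_cst (a 0 k) x v)))).
by rewrite subr0 expr1.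
Qed.

Lemma differentiable_sqdist (R : realType) (N : nat) (a x : 'rV[R]_N) :
  differentiable (sqdist a) x.
Proof.
pose h (k : 'I_N) (z : 'rV[R]_N) : R := (z 0 k - a 0 k) ^+ 2.
have -> : sqdist a = \sum_(k < N) h k by apply/funext => z; rewrite fct_sumE.
apply: differentiable_sum => k.
have D := @differentiable_coord R 1 N x 0 k.
have -> : h k = ((fun z : 'rV[R]_N => z 0 k : R) - cst (a 0 k)) ^+ 2 by [].
by apply: differentiableX; apply: differentiableB.
Qed.

Definition quad (R : realType) (N : nat) (s t : R) (a b : 'rV[R]_N) :=
  s *: sqdist a + t *: sqdist b.

Lemma gradient_quad (R : realType) (N : nat) (s t : R) (a b x : 'rV[R]_N) :
  gradient (quad s t a b) x = (2 * s) *: (x - a) + (2 * t) *: (x - b).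
Proof.
apply/rowP => k; rewrite /gradient !mxE -deriveE; last first.
  by apply: differentiableD; apply: differentiableZ; exact: differentiable_sqdist.
have Da := is_derive_sqdist a x (delta_mx 0 k).
have Db := is_derive_sqdist b x (delta_mx 0 k).
have [_ Dq] := is_deriveD (is_deriveZ s Da) (is_deriveZ t Db).
rewrite /quad Dq.
have E (c : 'rV[R]_N) : \sum_(l < N) 2 * (x 0 l - c 0 l) * (delta_mx 0 k : 'rV[R]_N) 0 l
   = 2 * (x 0 k - c 0 k).
  rewrite (bigD1 k)//= big1 ?addr0 ?mxE ?eqxx ?mulr1// => l lk.
  by rewrite mxE (negbTE lk) andbF mulr0.
by rewrite !E /GRing.scale/=; ring.
Qed.

Lemma C1_quad (R : realType) (N : nat) (s t : R) (a b x : 'rV[R]_N) :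
  C1_near (quad s t a b) x.
Proof.
apply: filterE => z; split.
  by apply: differentiableD; apply: differentiableZ; exact: differentiable_sqdist.
rewrite /prop_for/=.
have -> : gradient (quad s t a b) = fun x => (2 * s) *: (x - a) + (2 * t) *: (x - b).
  by apply/funext => x'; exact: gradient_quad.
have cB c : {for z, continuous (fun x' : 'rV[R]_N => x' - c)}.
  by apply: continuousB; [exact: cvg_id|exact: cst_continuous].
have C (r : R) c := @continuousZl_tmp R _ _ _ r _ (cB c).
exact: (continuousD (C _ a) (C _ b)).
Qed.

(** * Doubling of variables *)

(** When [w - v] is minimal at [y], the term [sqdist y] makes [(y, y)] the only
    minimum point on the diagonal. *)
Definition gap (R : realType) (N : nat) (v w : 'rV[R]_N -> R) (y : 'rV[R]_N)
    (p : 'rV[R]_N * 'rV[R]_N) : R :=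
  (w p.1 - v p.2) - (w y - v y) + sqdist y p.1.

Lemma gap_continuous (R : realType) (N : nat) (v w : 'rV[R]_N -> R)
    (y : 'rV[R]_N) :
  continuous v -> continuous w -> continuous (gap v w y).
Proof.
move=> cv cw.
have c1 := continuous_comp_fst (U := 'rV[R]_N) cw.
have c2 := continuous_comp_snd (T := 'rV[R]_N) cv.
have c3 : continuous (fun p : 'rV[R]_N * 'rV[R]_N => sqdist y p.1).
  apply: (@continuous_comp_fst _ _ _ (sqdist y)) => x.
  exact: differentiable_continuous (differentiable_sqdist y x).
move=> p; apply: (continuousD _ (c3 p)).
by apply: continuousB; [apply: continuousB; [exact: c1|exact: c2]|exact: cst_continuous].
Qed.

(** The minimum points of the penalised function on a closed ball must lie in
    the open ball for large [n], which makes them local minimum points.  Off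
    the diagonal the penalty becomes large, on the diagonal [gap] is positive
    except at [(y, y)], and compactness makes a single [n] enough. *)
Lemma penalised_localised (R : realType) (N : nat) (v w : 'rV[R]_N -> R)
    (y : 'rV[R]_N) (d : R) :
  continuous v -> continuous w -> (forall x, w y - v y <= w x - v x) ->
  0 < d ->
  \forall n \near \oo, forall p : 'rV[R]_N * 'rV[R]_N,
    `|p.1 - y| <= d -> `|p.2 - y| <= d ->
    gap v w y p + n%:R * sqdist p.2 p.1 <= 0 -> `|p.1 - y| < d /\ `|p.2 - y| < d.
Proof.
move=> cv cw wv_min d0.
have cG := @gap_continuous _ _ _ _ y cv cw.
pose K := [set x : 'rV[R]_N | `|x - y| <= d].
pose P (n : nat) (p : 'rV[R]_N * 'rV[R]_N) :=
  gap v w y p + n%:R * sqdist p.2 p.1 <= 0 -> `|p.1 - y| < d /\ `|p.2 - y| < d.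
have cK : compact (K `*` K) by apply: compact_setX; exact: compact_ball.
suff : \forall n \near \oo, K `*` K `<=` P n.
  by apply: filterS => n KP p p1 p2; exact: KP.
move/compact_near_coveringP : cK; apply => -[a b] _.
have [eab|ab] := eqVneq a b; last first.
  have s0 : 0 < sqdist b a by exact: sqdist_gt0.
  pose s := sqdist b a / 2; have {}s0 : 0 < s by exact: divr_gt0.
  exists ([set p | gap v w y (a, b) - 1 < gap v w y p /\ s < sqdist p.2 p.1],
          [set n : nat | (1 - gap v w y (a, b)) / s <= n%:R]) => /=.
    split; last exact: nbhs_infty_ger.
    apply: filterI.
      by apply: nbhs_gt cG _; rewrite ltrBlDr ltrDl.
    apply: nbhs_gt (@sqdist_continuous R N) _ => /=.
    by move: s0; rewrite /s; lra.
  (* For such p and n, n * sqdist p.2 p.1 is at least 1 - gap (a, b), which makes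
     the sum positive. *)
  move=> [p n] [/= [gp sp] nc]; rewrite /P leNgt => /negP[].
  have : 1 - gap v w y (a, b) <= n%:R * sqdist p.2 p.1.
    rewrite -(divfK (lt0r_neq0 s0) (1 - _)).
    apply: le_trans (ler_wpM2l (ler0n _ n) (ltW sp)).
    exact: ler_wpM2r (ltW s0) _ _ nc.
  lra.
subst b; have [->|ay] := eqVneq a y.
  exists ([set p | `|p.1 - y| < d /\ `|p.2 - y| < d], setT) => /=.
    split; last exact: filterT.
    have B : nbhs y [set x | `|x - y| < d].
      by apply: nbhs_lt (@continuous_dist _ _ y) _; rewrite subrr normr0.
    by exists ([set x | `|x - y| < d], [set x | `|x - y| < d]) => //= -[].
  by move=> [p n] [/= pd _] _.
exists ([set p | 0 < gap v w y p], setT) => /=.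
  split; last exact: filterT.
  apply: nbhs_gt cG _.
  by rewrite /gap/= ltr_wpDl ?sqdist_gt0// ?subr_ge0//.
move=> [p n] [/= gp _]; rewrite /P leNgt => /negP[].
by rewrite ltr_wpDr// mulr_ge0// sqdist_ge0.
Unshelve. all: by end_near. Qed.

(** [x] and [z] come from a minimum point of
    [w x - v z + |x - y|^2 + n |x - z|^2]: freezing [z] gives a quadratic
    function that touches [w] from below at [x], freezing [x] gives one that
    touches [v] from above at [z].  The two copies of [n |x - z|^2] have
    opposite gradients [2 n (z - x)] and [2 n (x - z)], so that only the
    gradient of [|x - y|^2] separates the two test functions. *)
Lemma doubling (R : realType) (N : nat) (v w : 'rV[R]_N -> R) (y : 'rV[R]_N)
    (U : set 'rV[R]_N) :
  continuous v -> continuous w -> (forall x, w y - v y <= w x - v x) ->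
  nbhs y U ->
  exists x z q, [/\ U x, U z, superdifferential v z q
    & subdifferential w x (q - 2 *: (x - y))].
Proof.
move=> cv cw wv_min /nbhs_ballP[e /= e0 eU].
pose d := e / 2; have d0 : 0 < d by exact: divr_gt0.
have dU x : `|x - y| < d -> U x.
  move=> xd; apply: eU; rewrite -ball_normE /= distrC (lt_trans xd)//.
  by rewrite /d; move: e0; lra.
have [n _ /(_ n (leqnn n)) nP] := penalised_localised cv cw wv_min d0.
pose K := [set x : 'rV[R]_N | `|x - y| <= d].
pose Psi p := gap v w y p + n%:R * sqdist p.2 p.1.
have cPsi : continuous Psi.
  move=> p; apply: continuousD; first exact: gap_continuous cv cw _.
  apply: continuousM; first exact: cst_continuous.
  exact: sqdist_continuous.
have Ky : K y by rewrite /K/= subrr normr0 ltW.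
have [||[x z] /set_mem[/= Kx Kz] Pmin] :=
    @compact_EVT_min _ R Psi (K `*` K) _
      (compact_setX (@compact_ball R N y d) (@compact_ball R N y d)).
- by exists (y, y); split.
- exact: continuous_subspaceT.
have [] := nP (x, z) Kx Kz.
  apply: le_trans (Pmin (y, y) _) _; first by apply/mem_set; split.
  by rewrite /Psi /gap/= !sqdistxx subrr mulr0 !addr0.
move=> /= xd zd.
have near_d c : `|c - y| < d -> \forall t \near c, `|t - y| <= d.
  by move=> /(nbhs_lt (@continuous_dist _ _ y)); apply: filterS => t; exact: ltW.
exists x, z, ((2 * n%:R) *: (z - x)); split; [exact: dU|exact: dU| |].
- exists (quad 0 n%:R y x); split.
  + exact: C1_quad.
  + by rewrite gradient_quad mulr0 scale0r add0r.
  + near=> t.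
    have : Psi (x, z) <= Psi (x, t).
      by apply: Pmin; apply/mem_set; split => //=; near: t; exact: near_d.
    rewrite /Psi /gap /quad /= !fctE /GRing.scale /= (sqdistC x t) (sqdistC x z); lra.
- exists (quad (- 1) (- n%:R) y z); split.
  + exact: C1_quad.
  + by rewrite gradient_quad !mulrN mulr1 !scaleNr addrC -scalerN opprB.
  + near=> t.
    have : Psi (x, z) <= Psi (t, z).
      by apply: Pmin; apply/mem_set; split => //=; near: t; exact: near_d.
    rewrite /Psi /gap /quad /= !fctE /GRing.scale /=; lra.
Unshelve. all: by end_near. Qed.

(** * Comparison at a contact point *)

Lemma norm_le_euclidean (R : realType) (N : nat) (p : 'rV[R]_N) :
  `|p| <= euclidean_norm p.
Proof.
rewrite [leLHS]/Num.norm/= mx_normrE; apply/bigmax_leP; split; first exact: sqrtr_ge0.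
move=> [i k] _ /=; rewrite ord1 -sqrtr_sqr ler_sqrt; last first.
  by apply: sumr_ge0 => *; exact: sqr_ge0.
by rewrite (bigD1 k)//= lerDl sumr_ge0// => *; exact: sqr_ge0.
Qed.

Lemma sublevel_bounded (R : realType) (N : nat) (H : 'rV[R]_N -> 'rV[R]_N -> R) (c : R) :
  convex_hamiltonian H -> exists M, forall x p, H x p <= c -> `|p| <= M.
Proof.
move=> [_ _ _ [alpha [beta [aoo _ Hab]]]].
have [M [_ Mc]] := cvgry_ge aoo (c + 1).
exists (M + 1) => x p Hc; rewrite leNgt; apply/negP => Mp.
have /Mc : M < euclidean_norm p.
  by rewrite (lt_le_trans _ (norm_le_euclidean p))// (lt_trans _ Mp)// ltrDl.
have /andP[+ _] := Hab x p.
lra.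
Qed.

(** If [g y < f y], the function [G] of the proof is positive at [((y, y), q)]
    for every [q], hence at [((x, z), q)] for [x] and [z] close to [y] and all
    [q] in a compact set.  By coercivity that set can be chosen to contain the
    superdifferentials of [v] near [y]; but the two equations at the points
    given by [doubling] say that [G] is nonpositive there. *)
Lemma contact (R : realType) (N : nat) (H : 'rV[R]_N -> 'rV[R]_N -> R)
    (v w f g : 'rV[R]_N -> R) (y : 'rV[R]_N) :
  convex_hamiltonian H ->
  continuous v -> continuous w -> continuous f -> continuous g ->
  (forall x p, superdifferential v x p -> H x p <= g x) ->
  (forall x p, subdifferential w x p -> f x <= H x p) ->
  (forall x, w y - v y <= w x - v x) ->
  f y <= g y.
Proof.
move=> HH cv cw cf cg vsub wsup wv; rewrite leNgt; apply/negP => gf.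
have [M HM] := sublevel_bounded (g y + 1) HH.
have [_ cH _ _] := HH.
pose G (t : ('rV[R]_N * 'rV[R]_N) * 'rV[R]_N) :=
  (H t.1.2 t.2 - H t.1.1 (t.2 - 2 *: (t.1.1 - y))) + (f t.1.1 - g t.1.2).
have cG : continuous G.
  have c11 : continuous (fun t : ('rV[R]_N * 'rV[R]_N) * 'rV[R]_N => t.1.1).
    by apply: (@continuous_comp_fst _ _ _ fst) => p; exact: cvg_fst.
  have c12 : continuous (fun t : ('rV[R]_N * 'rV[R]_N) * 'rV[R]_N => t.1.2).
    by apply: (@continuous_comp_fst _ _ _ snd) => p; exact: cvg_snd.
  have c2 : continuous (fun t : ('rV[R]_N * 'rV[R]_N) * 'rV[R]_N => t.2).
    by move=> p; exact: cvg_snd.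
  have c3 : continuous (fun t : ('rV[R]_N * 'rV[R]_N) * 'rV[R]_N =>
      t.2 - 2 *: (t.1.1 - y)).
    move=> t; apply: continuousB; first exact: c2.
    apply: (@continuousZl_tmp R 'rV[R]_N _
      (fun t : ('rV[R]_N * 'rV[R]_N) * 'rV[R]_N => t.1.1 - y)).
    by apply: continuousB; [exact: c11|exact: cst_continuous].
  have cH1 := continuous_comp2 cH c12 c2.
  have cH2 := continuous_comp2 cH c11 c3.
  have cf1 : continuous (fun t : ('rV[R]_N * 'rV[R]_N) * 'rV[R]_N => f t.1.1).
    by move=> t; apply: continuous_comp; [exact: c11|exact: cf].
  have cg1 : continuous (fun t : ('rV[R]_N * 'rV[R]_N) * 'rV[R]_N => g t.1.2).
    by move=> t; apply: continuous_comp; [exact: c12|exact: cg].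
  move=> t.
  exact: (continuousD (continuousB (cH1 t) (cH2 t)) (continuousB (cf1 t) (cg1 t))).
pose K := [set q : 'rV[R]_N | `|q| <= M].
have cK : compact K by have := @compact_ball R N 0 M; under eq_fun do rewrite subr0.
have [U [Uy UK]] : exists U, nbhs y U /\ forall x z, U x -> U z -> g z <= g y + 1 /\
    forall q, K q -> 0 < G ((x, z), q).
  have : \forall p \near (y, y), K `<=` [set q | 0 < G (p, q)].
    have cov := (compact_near_coveringP K).1 cK.
    apply: (cov _ (nbhs (y, y)) (fun p q => 0 < G (p, q)) (nbhs_filter (y, y))) => q _.
    have Gq : 0 < G ((y, y), q).
      by rewrite /G/= subrr scaler0 subr0 subrr add0r subr_gt0.
    have [[C D] [/= Cy Dq] CD] := nbhs_gt cG Gq.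
    by exists (D, C) => // -[q' p] [/= Dq' Cp]; exact: (CD (p, q')).
  move=> [[C D] [/= Cy Dy] CD].
  exists (C `&` D `&` [set z | g z < g y + 1]); split.
    by apply: filterI; [exact: filterI|apply: nbhs_lt cg _; rewrite ltrDl].
  move=> x z [[Cx _] _] [[_ Dz] /ltW gz]; split=> // q.
  exact: (CD (x, z)).
have [x [z [q [Ux Uz vq wq]]]] := doubling cv cw wv Uy.
have [gz GK] := UK _ _ Ux Uz.
have Hz := vsub _ _ vq; have Hx := wsup _ _ wq.
have := GK q (HM _ _ (le_trans Hz gz)); rewrite /G/=; lra.
Qed.

Theorem theorem5p1 (R : realType) (N m : nat) (hN : (0 < N)%N) (hm : (0 < m)%N)
    (H : 'I_m -> 'rV[R]_N -> 'rV[R]_N -> R) (B : 'rV[R]_N -> 'M[R]_m)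
    (hH : forall i, convex_hamiltonian (H i))
    (hBcont : forall i j, torus_continuous (fun x => B x i j))
    (hBdeg : forall x, degenerate_coupling_matrix (B x))
    (hBirr : forall x, irreducible_matrix (B x))
    (hc : critical_value H B = 0%:E)
    (j : 'I_m) (y : 'rV[R]_N) (hy : aubry_set H B j y) (i : 'I_m) :
  (forall v, subsolutions H B 0 v ->
     forall k, (v k y)%:E = (Phi H B k i y y + (v i y)%:E)%E) /\
  (forall v w, subsolutions H B 0 v -> subsolutions H B 0 w ->
     exists t : R, forall k, v k y - w k y = t).
Proof.
case: hy => u [[cu _] [_ usup]] Phiu.
have contact_all v : subsolutions H B 0 v -> forall k, v k y - v j y = u k y.
  move=> vS; have [cv vsub] := vS.
  have le_u k x : v k x - v j y <= u k x.
    by rewrite -lee_fin -Phiu; apply: ereal_sup_ubound; exists v.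
  pose I : {set 'I_m} := [set k | v k y - v j y == u k y]%SET.
  (* The supremum that defines u_j(y) is over the single value 0. *)
  have ujy : u j y = 0.
    apply/eqP; rewrite eq_le -{2}(subrr (v j y)) le_u andbT -lee_fin -Phiu.
    by apply: ge_ereal_sup => _ [v' _ <-]; rewrite subrr.
  have jI : j \in I by rewrite inE subrr ujy.
  suff IT : I = [set: 'I_m]%SET.
    by move=> k; have := finset.in_setT k; rewrite -IT inE => /eqP.
  apply/eqP; apply: contraT => IT.
  have [||l [k [lI kI Blk]]] := hBirr y I.
  - by apply/set0Pn; exists j.
  - by rewrite properT.
  have ul : v l y - v j y = u l y by move: lI; rewrite inE => /eqP.
  have cpl (z : 'I_m -> 'rV[R]_N -> R) : (forall i, torus_continuous (z i)) ->
      continuous (fun x => - coupling_term B z l x).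
    move=> cz x; apply: continuousN; move: x; apply: continuous_sum => h x.
    by apply: continuousM; [exact: (hBcont l h).2|exact: (cz h).2].
  have : - coupling_term B u l y <= - coupling_term B v l y.
    apply: (contact (hH l) (cv l).2 (cu l).2 (cpl _ cu) (cpl _ cv)).
    - by move=> x p /vsub; lra.
    - by move=> x p /usup; lra.
    - by move=> x; have := le_u l x; lra.
  (* The degenerate rows of B make the constant v_j(y) invisible. *)
  suff : 0 < \sum_(h < m) B y l h * (v h y - v j y - u h y).
    under eq_bigr do rewrite !mulrBr.
    rewrite !sumrB -mulr_suml (hBdeg y).2 mul0r subr0 /coupling_term; lra.
  have term_ge0 h : 0 <= B y l h * (v h y - v j y - u h y).
    have [->|hl] := eqVneq h l; first by rewrite ul subrr mulr0.
    by rewrite mulr_le0 ?(hBdeg y).1.1// subr_le0.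
  rewrite (bigD1 k)//= ltr_pwDl ?sumr_ge0//.
  have kl : k != l by apply: contraNneq kI => ->.
  rewrite nmulr_rgt0 ?subr_lt0 lt_neqAle.
    by rewrite le_u andbT; move: kI; rewrite inE.
  by rewrite Blk (hBdeg y).1.1.
have const v v' : subsolutions H B 0 v -> subsolutions H B 0 v' ->
    forall k, v k y - v i y = v' k y - v' i y.
  move=> vS v'S k.
  have := contact_all _ vS k; have := contact_all _ vS i.
  have := contact_all _ v'S k; have := contact_all _ v'S i; lra.
split=> [v vS k|v v' vS v'S].
  suff -> : Phi H B k i y y = (v k y - v i y)%:E by rewrite -EFinD subrK.
  rewrite /Phi (_ : [set _ | _ in _] = [set (v k y - v i y)%:E]) ?ereal_sup1//.
  apply/seteqP; split => [_ [v' v'S <-]|_ ->] /=; last by exists v.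
  by rewrite (const v' v).
exists (v i y - v' i y) => k; have := const _ _ vS v'S k; lra.
Qed.
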